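(* Let $(M,\eta,\omega)$ be a compact connected cosymplectic manifold. If $\Phi_F=\{\phi_t\}$ is any co-Hamiltonian isotopy such that $I_{\eta,\omega}(\dot\phi_t)=dF_t$ for all $t$, then there exists a positive constant $C(F,\eta)$, which depends on $F$ and $\eta$, such that for any two smooth monotonic functions $\xi_1,\xi_2:[0,1]\to[0,1]$, $$D_{CH}^{(1,\infty)}(\Phi_F^{\xi_1},\Phi_F^{\xi_2})\leq C(F,\eta)\,\|\xi_1-\xi_2\|_{ham}.$$
   Context: A cosymplectic structure on a smooth manifold $M$ is a pair $(\eta,\omega)$ of a closed $1$-form $\eta$ and a closed $2$-form $\omega$ such that for each $x\in M$ the linear map $T_xM\to T_x^\ast M$, $Y\mapsto \iota(Y)\omega_x+\eta_x(Y)\eta_x$ is a bijection. For a vector field $X$ put $I_{\eta,\omega}(X):=\iota(X)\omega+\eta(X)\eta$. A cosymplectic isotopy is a smooth isotopy $\Phi=\{\phi_t\}_{t\in[0,1]}$ of $M$, $\phi_0=id_M$, with $\phi_t^\ast\eta=\eta$ and $\phi_t^\ast\omega=\omega$ for each $t$; $\dot\phi_t$ denotes the vector field $\frac{d\phi_t}{dt}\circ\phi_t^{-1}$. It is co-Hamiltonian if $I_{\eta,\omega}(\dot\phi_t)$ is exact for each $t$; one writes $\Phi_F$ when $I_{\eta,\omega}(\dot\phi_t)=dF_t$ with $F:(t,x)\mapsto F_t(x)$ a smooth function on $[0,1]\times M$. For a smooth $\xi:[0,1]\to[0,1]$, $\Phi_F^{\xi}$ denotes the reparameterized path $t\mapsto\phi_{\xi(t)}$,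 which is generated by $F^\xi:t\mapsto\dot\xi(t)F_{\xi(t)}$ (its velocity at time $t$ is $\dot\xi(t)\dot\phi_{\xi(t)}$). $C(\Phi,\eta)^t$ denotes the function $x\mapsto\eta(\dot\phi_t)(\phi_t(x))$; for smooth paths $\Phi=\{\phi_t\}_{t\in[0,1]}$ of diffeomorphisms of $M$ satisfying $\phi_t^\ast\eta=\eta$ and $\phi_t^\ast\omega=\omega$ for each $t$ (in particular for co-Hamiltonian isotopies $\Phi_F$ and their reparameterizations $\Phi_F^{\xi}$) it is constant on $M$ for each $t$ and is identified with its constant value. For a function $f$ on $M$, $osc(f)=\max_Mf-\min_Mf$. For paths $\Phi_F,\Psi_H$ generated by $F$ and $H$, $$D_{CH}^{(1,\infty)}(\Phi_F,\Psi_H)=\int_0^1\left(osc(F_t-H_t)+|C(\Phi_F,\eta)^t-C(\Psi_H,\eta)^t|\right)dt.$$ For a smooth $\xi:[0,1]\to\mathbb{R}$, $\|\xi\|_{ham}=\sup_t|\xi(t)|+\int_0^1|\dot\xi(t)|\,dt$. *)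

(* Defs.v *)
From HB Require Import structures.
From mathcomp Require Import all_boot all_order all_algebra.
From mathcomp Require Import all_classical all_reals all_analysis.
Import Order.TTheory GRing.Theory Num.Theory.
Import numFieldNormedType.Exports.

Set Implicit Arguments.
Unset Strict Implicit.
Unset Printing Implicit Defensive.

Local Open Scope classical_set_scope.
Local Open Scope ring_scope.

Section Smoothness.
Context {R : realType} {V W : normedModType R}.

(* Meant for U open: f is k times differentiable on U, and its k-th iterated
   directional derivatives are continuous on U. *)
Fixpoint Ck (k : nat) (U : set V) (f : V -> W) : Prop :=
  match k with
  | 0 => forall x, U x -> {for x, continuous f}
  | j.+1 => (forall x, U x -> differentiable f x) /\
            (forall v : V, Ck j U (fun x => 'd f x v))
  end.

Definition Cinfty (U : set V) (f : V -> W) : Prop := forall k, Ck k U f.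

(* Smoothness of a map defined on a set A that need not be open (such as
   [0, 1] times an open set): f extends near p to a smooth map on an open set.
   The values of f outside A play no role. *)
Definition smooth_within (A : set V) (f : V -> W) (p : V) : Prop :=
  exists (U : set V) (g : V -> W),
    [/\ open_nbhs p U, Cinfty U g & forall y, A y -> U y -> f y = g y].

Definition smooth_on (A : set V) (f : V -> W) : Prop :=
  forall p, A p -> smooth_within A f p.

End Smoothness.

(* Derivative at t of a map defined on [0, 1]: the limit of difference quotients
   is taken inside [0, 1], hence is one-sided at t = 0 and t = 1. *)
Definition deriv01 (R : realType) (V : normedModType R) (f : R -> V) (t : R) : V :=
  lim ((fun s => (s - t)^-1 *: (f s - f t)) @ within `[0, 1] (t^')).

Record chart (R : realType) (n : nat) (M : topologicalType) := Chart {
  cdom : set M ;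
  cmap :> M -> 'rV[R]_n ;
  cinv : 'rV[R]_n -> M ;
  cdom_open : open cdom ;
  cimg_open : open (cmap @` cdom) ;
  cmapK : {in cdom, cancel cmap cinv} ;
  cmap_continuous : {within cdom, continuous cmap} ;
  cinv_continuous : {within cmap @` cdom, continuous cinv}
}.

Definition cimg (R : realType) (n : nat) (M : topologicalType) (c : chart R n M) :
  set 'rV[R]_n := c @` cdom c.

(* Smooth n-manifolds without boundary. The atlas need not be maximal. A
   preferred chart around each point is part of the data; it is used to identify
   the tangent space at x with R^n (row vectors) and the cotangent space with
   column vectors, the pairing of v and a being v *m a. *)
Record manifold (R : realType) (n : nat) := Manifold {
  carrier :> topologicalType ;
  atlas : set (chart R n carrier) ;
  chart_at : carrier -> chart R n carrier ;
  chart_at_atlas : forall x, atlas (chart_at x) ;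
  chart_at_dom : forall x, cdom (chart_at x) x ;
  transition_smooth : forall c c', atlas c -> atlas c' ->
    Cinfty (c @` (cdom c `&` cdom c')) (c' \o cinv c) ;
  carrier_hausdorff : hausdorff_space carrier ;
  carrier_second_countable : @second_countable carrier
}.

Section Manifold.
Context {R : realType} {n : nat} (M : manifold R n).

Definition vector_field := M -> 'rV[R]_n.
Definition one_form := M -> 'cV[R]_n.

(* The matrix b x represents the bilinear form (u, v) |-> u *m b x *m v^T on the
   tangent space at x; see alternating below. *)
Definition two_form := M -> 'M[R]_n.

Definition alternating (b : two_form) : Prop := forall x, (b x)^T = - b x.

(* Jacobian of the inverse of c at y, as a map from R^n to the tangent space at
   cinv c y, in the row-vector convention v |-> v *m J. *)
Definition coord_frame (c : chart R n M) (y : 'rV[R]_n) : 'M[R]_n :=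
  'J (chart_at (cinv c y) \o cinv c) y.

(* Coefficients of forms in the coordinates of the chart c. *)
Definition coef1 (a : one_form) (c : chart R n M) (y : 'rV[R]_n) : 'cV[R]_n :=
  coord_frame c y *m a (cinv c y).
Definition coef2 (b : two_form) (c : chart R n M) (y : 'rV[R]_n) : 'M[R]_n :=
  coord_frame c y *m b (cinv c y) *m (coord_frame c y)^T.

Definition smooth1 (a : one_form) : Prop :=
  forall c, atlas c -> Cinfty (cimg c) (coef1 a c).
Definition smooth2 (b : two_form) : Prop :=
  forall c, atlas c -> Cinfty (cimg c) (coef2 b c).

Definition partial (f : 'rV[R]_n -> R) (i : 'I_n) (y : 'rV[R]_n) : R :=
  'D_(delta_mx 0 i) (f : 'rV[R]_n -> R^o) y.

(* Vanishing of the exterior derivative, in coordinates. *)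
Definition closed1 (a : one_form) : Prop :=
  forall c, atlas c -> forall y, cimg c y -> forall i j : 'I_n,
    partial (fun z => coef1 a c z j 0) i y
    - partial (fun z => coef1 a c z i 0) j y = 0.
Definition closed2 (b : two_form) : Prop :=
  forall c, atlas c -> forall y, cimg c y -> forall i j k : 'I_n,
    partial (fun z => coef2 b c z j k) i y
    - partial (fun z => coef2 b c z i k) j y
    + partial (fun z => coef2 b c z i j) k y = 0.

(* I_{eta,omega}(Y) at x, i.e. iota(Y) omega + eta(Y) eta, for Y tangent at x. *)
Definition Icosymp (eta : one_form) (omega : two_form) (x : M) (Y : 'rV[R]_n) :
  'cV[R]_n := (Y *m omega x)^T + (Y *m eta x) 0 0 *: eta x.

Record cosymplectic (eta : one_form) (omega : two_form) : Prop := Cosymplectic {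
  eta_smooth : smooth1 eta ;
  eta_closed : closed1 eta ;
  omega_alternating : alternating omega ;
  omega_smooth : smooth2 omega ;
  omega_closed : closed2 omega ;
  Icosymp_bijective : forall x, bijective (Icosymp eta omega x)
}.

Definition dfun (f : M -> R) : one_form := fun x =>
  \col_i ('d (f \o cinv (chart_at x) : 'rV[R]_n -> R^o) (chart_at x x)
            (delta_mx 0 i)).

Definition smooth_map (f : M -> M) : Prop :=
  continuous f /\
  forall x, smooth_within (cimg (chart_at x))
    (chart_at (f x) \o f \o cinv (chart_at x)) (chart_at x x).

Definition diffeo (f : M -> M) : Prop :=
  smooth_map f /\ exists g, [/\ smooth_map g, cancel f g & cancel g f].

(* Differential of f at x, from the tangent space at x to the one at f x. *)
Definition tangent_map (f : M -> M) (x : M) : 'M[R]_n :=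
  'J (chart_at (f x) \o f \o cinv (chart_at x)) (chart_at x x).

Definition pullback1 (f : M -> M) (a : one_form) : one_form := fun x =>
  tangent_map f x *m a (f x).
Definition pullback2 (f : M -> M) (b : two_form) : two_form := fun x =>
  tangent_map f x *m b (f x) *m (tangent_map f x)^T.

(* Objects depending on a time t in [0, 1] are functions of t : R whose values
   for t outside [0, 1] are irrelevant. *)

Definition smooth_time_fun (F : R -> M -> R) : Prop :=
  forall (t : R) x, t \in `[0, 1] ->
    smooth_within (`[0, 1] `*` cimg (chart_at x) : set (R^o * 'rV[R]_n))
      (fun p => F p.1 (cinv (chart_at x) p.2) : R^o)
      ((t : R^o), chart_at x x).

Definition smooth_time_map (Phi : R -> M -> M) : Prop :=
  {within `[0, 1] `*` [set: M], continuous (fun p : R * M => Phi p.1 p.2)} /\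
  forall (t : R) x, t \in `[0, 1] ->
    smooth_within (`[0, 1] `*` cimg (chart_at x) : set (R^o * 'rV[R]_n))
      (fun p => chart_at (Phi t x) (Phi p.1 (cinv (chart_at x) p.2)))
      ((t : R^o), chart_at x x).

Record cosymplectic_isotopy (eta : one_form) (omega : two_form)
    (Phi : R -> M -> M) : Prop := CosymplecticIsotopy {
  isotopy_smooth : smooth_time_map Phi ;
  isotopy_diffeo : forall t : R, t \in `[0, 1] -> diffeo (Phi t) ;
  isotopy0 : forall x, Phi 0 x = x ;
  isotopy_eta : forall t : R, t \in `[0, 1] -> pullback1 (Phi t) eta = eta ;
  isotopy_omega : forall t : R, t \in `[0, 1] -> pullback2 (Phi t) omega = omega
}.

(* The velocity at time t of the curve s |-> phi_s(x). It is tangent at phi_t(x),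
   and is the value at phi_t(x) of the vector field \dot\phi_t. *)
Definition velocity (Phi : R -> M -> M) (t : R) (x : M) : 'rV[R]_n :=
  deriv01 (fun s => chart_at (Phi t x) (Phi s x)) t.

Definition is_dot (Phi : R -> M -> M) (t : R) (X : vector_field) : Prop :=
  forall x, X (Phi t x) = velocity Phi t x.

(* Phi is a co-Hamiltonian isotopy with I_{eta,omega}(\dot\phi_t) = dF_t. *)
Record co_hamiltonian (eta : one_form) (omega : two_form)
    (Phi : R -> M -> M) (F : R -> M -> R) : Prop := CoHamiltonian {
  coham_isotopy : cosymplectic_isotopy eta omega Phi ;
  coham_smooth : smooth_time_fun F ;
  coham_exact : forall t : R, t \in `[0, 1] -> exists2 X : vector_field,
    is_dot Phi t X & forall y, Icosymp eta omega y (X y) = dfun (F t) y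
}.

Definition C_fun (Phi : R -> M -> M) (eta : one_form) (t : R) (x : M) : R :=
  (velocity Phi t x *m eta (Phi t x)) 0 0.

(* The constant value of C_fun Phi eta t. *)
Definition C_val (Phi : R -> M -> M) (eta : one_form) (t : R) : R :=
  xget 0 [set c : R | forall x, C_fun Phi eta t x = c].

(* The supremum and infimum are attained when f is continuous on a compact M. *)
Definition osc (f : M -> R) : R := sup (range f) - inf (range f).

Definition D_CH (eta : one_form) (Phi : R -> M -> M) (F : R -> M -> R)
    (Psi : R -> M -> M) (H : R -> M -> R) : \bar R :=
  (\int[lebesgue_measure]_(t in `[0%R, 1%R])
     (osc (fun x => F t x - H t x) + `|C_val Phi eta t - C_val Psi eta t|)%:E)%E.

Definition reparam (Phi : R -> M -> M) (xi : R -> R) : R -> M -> M :=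
  fun t => Phi (xi t).

Definition reparam_gen (F : R -> M -> R) (xi : R -> R) : R -> M -> R :=
  fun t x => deriv01 (xi : R -> R^o) t * F (xi t) x.

End Manifold.

Definition ham_norm (R : realType) (xi : R -> R) : \bar R :=
  ((sup [set `|xi t| | t in `[0, 1]])%:E +
   \int[lebesgue_measure]_(t in `[0%R, 1%R]) `|deriv01 (xi : R -> R^o) t|%:E)%E.

Definition monotone01 (R : realType) (xi : R -> R) : Prop :=
  {in `[0, 1] &, {homo xi : s t / s <= t}} \/
  {in `[0, 1] &, {homo xi : s t /~ s <= t}}.

Record smooth_monotone01 (R : realType) (xi : R -> R) : Prop := SmoothMonotone01 {
  xi_smooth : smooth_on (`[0, 1] : set R^o) (xi : R^o -> R^o) ;
  xi_range : forall t : R, t \in `[0, 1] -> xi t \in `[0, 1] ;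
  xi_monotone : monotone01 xi
}.

(* Main.v *)
Require Import Defs.
From mathcomp Require Import all_boot all_order all_algebra.
From mathcomp Require Import all_classical all_reals all_analysis.
From mathcomp Require Import measurable_realfun.
From mathcomp Require Import ring lra.
Import Order.TTheory GRing.Theory Num.Theory.
Import numFieldNormedType.Exports.

(** Two estimates are added: one for the oscillation term of the distance and
    one for the term that compares the constants C(-, eta).

    The oscillation term. Write A = xi1' and B = xi2'. Then
      A F_(xi1) - B F_(xi2) = (A - B) F_(xi1) + B (F_(xi1) - F_(xi2)).
    On the compact space [0, 1] x M, both F and its time derivative are bounded
    by some K (global_bound), so by the mean value theorem in time
    (locally_derivable_lipschitz) the function on the left is bounded at time t by
      K |A - B| + K |B| |xi1(t) - xi2(t)|,
    and its oscillation by twice that (osc_reparam_le). Integrating gives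
      2 K (int |xi1' - xi2'| + sup |xi1 - xi2| int |xi2'|).
    As xi2 is monotone with values in [0, 1], its total variation
    int |xi2'| = |xi2(1) - xi2(0)| is at most 1 (monotone_variation), and the
    bound becomes 2 K times the ham-norm of xi1 - xi2.

    The constants. On a nonempty closed manifold they all vanish: F_t attains its maximum
    at some y, where dF_t = 0, hence I(X) = 0 for the velocity field X, hence
    X(y) = 0 because I is injective, and eta(X) vanishes at y. Reparameterizing
    multiplies the velocity by xi' (velocity_reparam), so the vanishing persists
    (C_val_reparam). The constant 2 K is thus obtained from F alone, before Phi is
    given. *)

Set Implicit Arguments.
Unset Strict Implicit.
Unset Printing Implicit Defensive.

Local Open Scope classical_set_scope.
Local Open Scope ring_scope.

(** * One-sided derivatives on the unit interval *)

Section LocalTheory.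
Context {R : realType}.

(** [deriv01] is a limit along this filter, whose properness makes limits unique. *)
Lemma within01_dnbhs_proper (t : R) : t \in `[0, 1] ->
  ProperFilter (within `[0, 1] (t^')).
Proof.
rewrite in_itv /= => /andP[t0 t1]; apply: Build_ProperFilter_ex => P.
move=> [e /= e0 he].
have [t12|t12] := leP t (2^-1).
  exists (t + Num.min (e / 2) (1 / 2)); apply: he => /=.
  - rewrite opprD addrA subrr sub0r normrN ger0_norm; last first.
      by rewrite le_min !divr_ge0// ltW.
    by rewrite gt_min ltr_pdivrMr// ltr_pMr// ltr1n.
  - by rewrite -subr_eq0 addrC addKr gt_eqF// lt_min !divr_gt0.
  - rewrite in_itv /= addr_ge0//=; last by rewrite le_min !divr_ge0// ltW.
    rewrite [leRHS](splitr 1) lerD//; first by rewrite div1r.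
    by rewrite ge_min lexx orbT.
exists (t - Num.min (e / 2) (1 / 2)); apply: he => /=.
- rewrite opprB addrC subrK ger0_norm; last first.
    by rewrite le_min !divr_ge0// ltW.
  by rewrite gt_min ltr_pdivrMr// ltr_pMr// ltr1n.
- by rewrite -subr_eq0 addrC addKr oppr_eq0 gt_eqF// lt_min !divr_gt0.
- rewrite in_itv /=; apply/andP; split.
    by rewrite subr_ge0 ge_min div1r (ltW t12) orbT.
  by rewrite (le_trans _ t1)// gerBl le_min !divr_ge0// ltW.
Qed.

(** Smoothness on a closed set is stated through local extensions g; this lemma
    transfers ordinary derivatives of g to one-sided derivatives of f. *)
Lemma cvg_deriv01 {V : normedModType R} (f g : R -> V) (t : R) (d : V) :
  (\forall s \near t, s \in `[0, 1] -> f s = g s) -> t \in `[0, 1] ->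
  is_derive t 1 g d ->
  (s - t)^-1 *: (f s - f t) @[s --> within `[0, 1] (t^')] --> d.
Proof.
move=> fg t01 [dg <-].
rewrite /derive.
move: dg; rewrite /derivable; set q := fun h => _; move=> dg.
have qc : (q \o (fun s => s - t)) @ (t^') --> lim (q h @[h --> 0^']).
  apply: cvg_comp; last exact: dg.
  move=> P /= P0.
  have H : \forall s \near t, (fun h => h != 0 -> P h) (s - t).
    rewrite (near_shift 0) /= subr0.
    have : \forall h \near (0:R), h != 0 -> P h by exact: P0.
    by apply: filterS => h; rewrite /= addrK.
  rewrite /dnbhs /within /=; apply: filterS H => s /= Ps st; apply: Ps.
  by rewrite subr_eq0.
apply: (@cvg_trans _ ((q \o (fun s => s - t)) @ within `[0, 1] (t^'))); last first.
  by apply: cvg_trans qc; apply: cvg_app; apply: cvg_within.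
apply: near_eq_cvg; rewrite !near_withinE.
have ft : f t = g t by exact: (nbhs_singleton fg).
apply: filterS fg => s fgs st s01.
by rewrite /q /= /GRing.scale /= mulr1 subrK fgs// ft.
Qed.

Lemma deriv01E {V : normedModType R} (f g : R -> V) (t : R) (d : V) :
  (\forall s \near t, s \in `[0, 1] -> f s = g s) -> t \in `[0, 1] ->
  is_derive t 1 g d -> deriv01 f t = d.
Proof.
move=> fg t01 dg; have PF := within01_dnbhs_proper t01.
by apply: cvg_lim => //; exact: cvg_deriv01 dg.
Qed.

(** [differentiable] is defined through a chosen candidate for the differential,
    so its locality is not immediate: a differential of f is exhibited as one of
    g, and the choice for g then has the same property. *)
Lemma near_eq_differentiable {V W : normedModType R} (f g : V -> W) (a : V) :
  {near a, f =1 g} -> differentiable f a -> differentiable g a.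
Proof.
move=> fg df; apply/diffP => /=.
apply: (@getPex _ (fun (dg : {linear V -> W}) => continuous dg /\
  forall y, g y = g (lim (nbhs a)) + dg (y - lim (nbhs a))
                  +o_(y \near a) (y - lim (nbhs a)))).
exists ('d f a); split; first exact: diff_continuous.
have := diffE df => /=.
have fga : f a = g a by exact: (nbhs_singleton fg).
rewrite lim_id// -fga => fE.
have /eqaddoP fo : f = (fun y => f a + 'd f a (y - a)) +o_a (fun y => y - a).
  by apply/funext => y; exact: fE.
suff gE : g = (fun y => f a + 'd f a (y - a)) +o_a (fun y => y - a).
  by move=> y; rewrite [in LHS]gE.
apply/eqaddoP => e e0; near=> y.
suff -> : (g - (fun y => f a + 'd f a (y - a))) y =
          (f - (fun y => f a + 'd f a (y - a))) y.
  by near: y; exact: fo.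
by rewrite !fctE; congr (_ - _); rewrite (near fg y).
Unshelve. all: by end_near. Qed.

End LocalTheory.

(** * Functions of class C^1 on the unit interval *)

Section C1.
Context {R : realType}.
Implicit Types f g : R -> R.

Lemma in01_near (x : R) : x \in `]0, 1[ -> \forall s \near x, s \in `[0, 1].
Proof.
move=> x01; have : \forall s \near x, s \in `]0, 1[ by exact: near_in_itvoo.
by apply: filterS => s; exact: subset_itv_oo_cc.
Qed.

Section Derivable.
Variable f : R -> R.
Hypothesis fext : forall t : R, t \in `[0, 1] ->
  exists2 g : R -> R, (\forall s \near t, s \in `[0, 1] -> f s = g s) &
    derivable g t 1.

Lemma locally_derivable_continuous : {within `[0, 1], continuous f}.
Proof.
apply/subspace_continuousP => t /= t01; have [g fg dg] := fext t01.
rewrite /from_subspace (nbhs_singleton fg)//.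
apply: (@cvg_trans _ (g @ within `[0, 1] (nbhs t))).
  apply: near_eq_cvg; rewrite near_withinE.
  by apply: filterS fg => s /[apply].
apply: cvg_within_filter; apply: differentiable_continuous.
exact/derivable1_diffP.
Qed.

Lemma locally_derivable_is_derive (x : R) :
  x \in `]0, 1[ -> is_derive x 1 f (deriv01 (f : R -> R^o) x).
Proof.
move=> x01; have x01' := subset_itv_oo_cc x01.
have [g fg dg] := fext x01'.
rewrite (deriv01E (V := R^o) fg x01' (derivableP dg)).
apply: near_eq_is_derive; last exact: derivableP.
have := in01_near x01; apply: filterS2 fg => s + s01.
by move=> /(_ s01) ->.
Qed.

Lemma locally_derivable_lipschitz (K : R) :
  (forall x, x \in `[0, 1] -> `|deriv01 (f : R -> R^o) x| <= K) ->
  forall s t, s \in `[0, 1] -> t \in `[0, 1] -> `|f s - f t| <= K * `|s - t|.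
Proof.
move=> fK; suff H s t : s \in `[0, 1] -> t \in `[0, 1] -> s < t ->
    `|f t - f s| <= K * `|t - s|.
  move=> s t s01 t01; have [st|ts|->] := ltgtP s t; last first.
  - by rewrite !subrr normr0 mulr0.
  - exact: H.
  - by rewrite distrC (distrC s); exact: H.
move=> s01 t01 st.
have sub : {subset `[s, t] <= `[0, 1]}.
  move=> u; move: s01 t01; rewrite !in_itv/= => /andP[s0 _] /andP[_ t1].
  by move=> /andP[su ut]; rewrite (le_trans s0 su) (le_trans ut t1).
have suboo : {subset `]s, t[ <= `]0, 1[}.
  move=> u; move: s01 t01; rewrite !in_itv/= => /andP[s0 _] /andP[_ t1].
  by move=> /andP[su ut]; rewrite (le_lt_trans s0 su) (lt_le_trans ut t1).
have [u ust ->] := MVT st (fun x xst => locally_derivable_is_derive (suboo x xst))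
   (continuous_subspaceW sub locally_derivable_continuous).
rewrite normrM ler_wpM2r// fK//.
exact/subset_itv_oo_cc/suboo.
Qed.

End Derivable.

(** The derivability is asked on a neighbourhood, and not only at t, so that
    the derivative of the extension can be compared with that of f around t. *)
Definition C1_on01 f := forall t : R, t \in `[0, 1] ->
  exists2 g : R -> R, (\forall s \near t, s \in `[0, 1] -> f s = g s) &
    (\forall s \near t, derivable g s 1) /\ {for t, continuous (derive1 g)}.

Lemma C1_on01_ext f : C1_on01 f -> forall t : R, t \in `[0, 1] ->
  exists2 g : R -> R, (\forall s \near t, s \in `[0, 1] -> f s = g s) &
    derivable g t 1.
Proof.
by move=> fC t /fC[g fg [dg _]]; exists g => //; exact: (nbhs_singleton dg).
Qed.

Lemma smooth_on_C1_on01 f : smooth_on (`[0, 1] : set R^o) (f : R^o -> R^o) ->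
  C1_on01 f.
Proof.
move=> fs t t01; have [U [g [[oU Ut] gC fg]]] := fs t t01.
have nU : \forall s \near t, U s by exact: open_nbhs_nbhs.
have [gd gc] := gC 1.
exists g.
  by apply: filterS nU => s Us s01; apply: fg.
split.
  by apply: filterS nU => s Us; apply/derivable1_diffP; exact: gd.
rewrite /prop_for /continuous_at derive1E'; last exact: gd.
apply: (@cvg_trans _ (('d g s (1 : R^o)) @[s --> t])); last exact: gc.
apply: near_eq_cvg; apply: filterS nU => s Us.
by rewrite derive1E'//; exact: gd.
Qed.

(** The local extensions near t depend on t, but at every point of [0, 1] near t
    the derivative of the one chosen at t is the one-sided derivative of f. *)
Lemma C1_on01_deriv_continuous f : C1_on01 f ->
  {within `[0, 1], continuous (deriv01 (f : R -> R^o))}.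
Proof.
move=> fC; apply/subspace_continuousP => t /= t01.
have [g fg [dg cg]] := fC t t01.
have E : \forall s \near t, s \in `[0, 1] -> (derive1 g) s = deriv01 (f : R -> R^o) s.
  apply: filterS2 (near_join fg) dg => s fgs dgs s01.
  rewrite (deriv01E (V := R^o) fgs s01 (derivableP dgs)).
  by rewrite derive1E.
rewrite /from_subspace -(nbhs_singleton E)//.
apply: (@cvg_trans _ ((derive1 g) @ within `[0, 1] (nbhs t))).
  apply: near_eq_cvg; rewrite near_withinE.
  by apply: filterS E => s /[apply].
exact: cvg_within_filter.
Qed.

Lemma C1_on01_cst (c : R) : C1_on01 (cst c).
Proof.
move=> t t01; exists (cst c); first by near=> s => _.
split; first by near=> s; exact: derivable_cst.
by apply: (@near_cst_continuous _ _ 0); near=> s; rewrite derive1_cst.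
Unshelve. all: by end_near. Qed.

Lemma C1_on01B f g : C1_on01 f -> C1_on01 g -> C1_on01 (f \- g).
Proof.
move=> fC gC t t01; have [f' ff' [df cf]] := fC t t01.
have [g' gg' [dg cg]] := gC t t01.
exists (f' - g').
  by apply: filterS2 ff' gg' => s fs gs s01 /=; rewrite !fctE fs// gs.
split.
  by apply: filterS2 df dg => s dfs dgs; exact: derivableB.
have E : \forall s \near t, (derive1 f') s - (derive1 g') s = derive1 (f' - g') s.
  by apply: filterS2 df dg => s dfs dgs; rewrite !derive1E deriveB.
rewrite /prop_for /continuous_at -(nbhs_singleton E).
apply: (@cvg_trans _ (((derive1 f') - (derive1 g')) @ t)).
  by apply: near_eq_cvg; exact: E.
exact: (cvgB cf cg).
Qed.

Lemma C1_on01_derivB f g t : C1_on01 f -> C1_on01 g -> t \in `[0, 1] ->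
  deriv01 (f \- g : R -> R^o) t =
  deriv01 (f : R -> R^o) t - deriv01 (g : R -> R^o) t.
Proof.
move=> fC gC t01; have [f' ff' df] := C1_on01_ext fC t01.
have [g' gg' dg] := C1_on01_ext gC t01.
rewrite (deriv01E (V := R^o) ff' t01 (derivableP df)).
rewrite (deriv01E (V := R^o) gg' t01 (derivableP dg)).
have E : \forall s \near t, s \in `[0, 1] -> (f \- g) s = (f' - g') s.
  by apply: filterS2 ff' gg' => s fs gs s01 /=; rewrite !fctE fs// gs.
exact: (deriv01E (V := R^o) E t01 (is_deriveB (derivableP df) (derivableP dg))).
Qed.

Lemma C1_on01_deriv_ge0 f : C1_on01 f ->
  {in `[0, 1] &, {homo f : s t / s <= t}} ->
  forall t, t \in `[0, 1] -> 0 <= deriv01 (f : R -> R^o) t.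
Proof.
move=> fC fm t t01; have [g fg dg] := C1_on01_ext fC t01.
rewrite (deriv01E (V := R^o) fg t01 (derivableP dg)).
have PF := within01_dnbhs_proper t01.
have H := cvg_deriv01 (V := R^o) fg t01 (derivableP dg).
rewrite -(cvg_lim (@norm_hausdorff _ R^o) H).
apply: limr_ge; first by apply/cvg_ex; exists ('D_1 g t).
rewrite near_withinE /dnbhs near_withinE; near=> s => st s01.
rewrite /GRing.scale /=.
have [st'|ts|E] := ltgtP s t; last by rewrite E eqxx in st.
- have := fm _ _ s01 t01 (ltW st').
  rewrite -mulrNN -invrN !opprB -subr_ge0.
  by apply: mulr_ge0; rewrite invr_ge0 subr_ge0 ltW.
- have := fm _ _ t01 s01 (ltW ts).
  by rewrite -subr_ge0; apply: mulr_ge0; rewrite invr_ge0 subr_ge0 ltW.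
Unshelve. all: by end_near. Qed.

Local Open Scope ereal_scope.

Lemma C1_on01_FTC f : C1_on01 f ->
  \int[lebesgue_measure]_(t in `[0%R, 1%R]) (deriv01 (f : R -> R^o) t)%:E =
  (f 1)%:E - (f 0)%:E.
Proof.
move=> fC; have fe := C1_on01_ext fC; apply: continuous_FTC2 => //.
- exact: C1_on01_deriv_continuous.
- have /continuous_within_itvP[] := locally_derivable_continuous fe; first by [].
  move=> _ f0 f1; split => // x x01.
  by have [] := locally_derivable_is_derive fe x01.
- by move=> x x01; rewrite derive1E; have [_ ->] := locally_derivable_is_derive fe x01.
Qed.

(** The derivative has a constant sign, so the integral of its absolute value is
    |f 1 - f 0|. *)
Lemma monotone_variation f : smooth_monotone01 f ->
  \int[lebesgue_measure]_(t in `[0%R, 1%R]) `|deriv01 (f : R -> R^o) t|%:E <= 1.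
Proof.
case=> /smooth_on_C1_on01 fC fr [fm|fm].
- rewrite [leLHS](_ : _ = \int[lebesgue_measure]_(t in `[0%R, 1%R])
      (deriv01 (f : R -> R^o) t)%:E).
    rewrite C1_on01_FTC// -EFinB lee_fin.
    have := fr 0%R; have := fr 1%R; rewrite !in_itv/= !lexx ler01.
    by move=> /(_ isT)/andP[a b] /(_ isT)/andP[c d]; lra.
  apply: eq_integral => t; rewrite inE /= => t01; rewrite ger0_norm//.
  exact: C1_on01_deriv_ge0.
- (* the nonincreasing case is the nondecreasing one for - f *)
  pose g := (cst 0 \- f)%R.
  have gC : C1_on01 g by apply: C1_on01B => //; exact: C1_on01_cst.
  rewrite [leLHS](_ : _ = \int[lebesgue_measure]_(t in `[0%R, 1%R])
      (deriv01 (g : R -> R^o) t)%:E).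
    rewrite C1_on01_FTC// -EFinB lee_fin /g /=.
    have := fr 0%R; have := fr 1%R; rewrite !in_itv/= !lexx ler01.
    by move=> /(_ isT)/andP[a b] /(_ isT)/andP[c d]; lra.
  apply: eq_integral => t; rewrite inE /= => t01; rewrite -normrN -[X in `|X|%R]add0r.
  have -> : (0 - deriv01 (f : R -> R^o) t)%R = deriv01 (g : R -> R^o) t.
    rewrite /g C1_on01_derivB//; last exact: C1_on01_cst.
    congr (_ - _)%R; symmetry; apply: (@deriv01E _ R^o _ (cst 0%R)) => //.
    by near=> s.
  rewrite ger0_norm//; apply: C1_on01_deriv_ge0 => // s u s01 u01 su.
  by rewrite /g /= lerB// fm.
Unshelve. all: by end_near. Qed.

End C1.

(** * Smooth time-dependent functions in charts *)

Lemma smooth_within_C1 {R : realType} {V W : normedModType R} (A : set V)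
    (f : V -> W) (p : V) : smooth_within A f p ->
  exists g, [/\ \forall q \near p, A q -> f q = g q,
    \forall q \near p, differentiable g q &
    forall v, {for p, continuous (fun q => 'd g q v)}].
Proof.
move=> [U [g [[oU Up] gC fg]]].
have nU : \forall q \near p, U q by exact: open_nbhs_nbhs.
have [gd gc] := gC 1; exists g; split.
- by apply: filterS nU => q Uq Aq; exact: fg.
- by apply: filterS nU => q; exact: gd.
- by move=> v; exact: gc.
Qed.

Lemma is_derive_slice {R : realType} {V W : normedModType R}
   (G : R^o * V -> W) (s : R^o) (z : V) : differentiable G (s, z) ->
  is_derive s 1 (fun u => G (u, z)) ('d G (s, z) (1, 0)).
Proof.
move=> dG; have := deriveE ((1, 0) : R^o * V) dG.
have := diff_derivable (v := ((1, 0) : R^o * V)) dG.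
rewrite /derivable /derive.
set q := (X in cvg (X @ _)).
suff E : q = fun h => h^-1 *: (((fun u => G (u, z)) \o shift s) (h *: 1) - G (s, z)).
  rewrite E => c <-; apply: DeriveDef => //.
  exact: (f_equal (fun k => lim (k @ (0 : R)^')) (esym E)).
apply/funext => h; rewrite /q /=; congr (_ *: (G _ - _)).
by congr pair; rewrite /= scaler0 add0r.
Qed.

(** The differential is linear, so it is enough to see that it is nonpositive in
    every direction, where it is the limit of the quotients with h > 0. *)
Lemma diff_at_max {R : realType} {V : normedModType R} (f : V -> R^o) (a v : V) :
  differentiable f a -> (forall b, f b <= f a) -> 'd f a v = 0.
Proof.
move=> df fa; suff H w : 'd f a w <= 0.
  by apply/eqP; rewrite eq_le H -oppr_le0 -linearN H.
rewrite -deriveE//.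
have cf : derivable f a w by exact: diff_derivable.
have cr := cvg_dnbhs_at_right cf.
rewrite /derive -(cvg_lim (@norm_hausdorff _ R^o) cr).
apply: limr_le; first by apply/cvg_ex; eexists; exact: cr.
near=> h; rewrite /= /GRing.scale /= pmulr_rle0 ?subr_le0//.
rewrite invr_gt0; near: h; exact: nbhs_right_gt.
Unshelve. all: by end_near. Qed.

Section Charts.
Context {R : realType} {n : nat} (M : manifold R n).
Implicit Types (x y : M) (F : R -> M -> R).

Lemma cdom_near x : \forall y \near x, cdom (chart_at x) y.
Proof. by apply: open_nbhs_nbhs; split; [exact: cdom_open|exact: chart_at_dom]. Qed.

Lemma chart_continuous x : {for x, continuous (chart_at x)}.
Proof.
have /subspace_continuousP /(_ x (chart_at_dom x)) := @cmap_continuous _ _ _ (chart_at x).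
by rewrite within_interior//; exact: cdom_near.
Qed.

Lemma cimg_near x : \forall z \near chart_at x x, cimg (chart_at x) z.
Proof.
apply: open_nbhs_nbhs; split; first exact: cimg_open.
by exists x => //; exact: chart_at_dom.
Qed.

Lemma chart_atK x y : cdom (chart_at x) y -> cinv (chart_at x) (chart_at x y) = y.
Proof. by move=> xy; apply: cmapK; rewrite inE. Qed.

Lemma time_chart_continuous t x :
  (q.1, chart_at x q.2) @[q --> ((t, x) : R * M)] --> ((t : R^o), chart_at x x).
Proof.
apply: (@cvg_pair _ _ _ _ (nbhs (t : R^o)) (nbhs (chart_at x x))) => /=.
  exact: cvg_fst.
apply: continuous_cvg; first exact: chart_continuous.
exact: cvg_snd.
Qed.

(** The smooth extension G of f in the chart at x serves all points near (t, x):
    on the manifold (first conclusion) and in coordinates (last one). *)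
Lemma time_rep {W : normedModType R} (f : R -> M -> W) t x :
  smooth_within (`[0, 1] `*` cimg (chart_at x) : set (R^o * 'rV[R]_n))
      (fun p => f p.1 (cinv (chart_at x) p.2))
      ((t : R^o), chart_at x x) ->
  exists G : R^o * 'rV[R]_n -> W,
   [/\ \forall q \near ((t, x) : R * M), q.1 \in `[0, 1] ->
           f q.1 q.2 = G (q.1, chart_at x q.2),
      \forall p \near ((t : R^o), chart_at x x), differentiable G p,
      {for ((t : R^o), chart_at x x), continuous (fun p => 'd G p (1, 0))}
     & \forall p \near ((t : R^o), chart_at x x), p.1 \in `[0, 1] ->
           f p.1 (cinv (chart_at x) p.2) = G p].
Proof.
move=> /smooth_within_C1[G [fG dG cG]]; exists G; split => //.
- have H : \forall q \near ((t, x) : R * M),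
      q.1 \in `[0, 1] /\ cimg (chart_at x) (chart_at x q.2) ->
      f q.1 (cinv (chart_at x) (chart_at x q.2)) = G (q.1, chart_at x q.2).
    exact: (time_chart_continuous fG).
  have D : \forall q \near ((t, x) : R * M), cdom (chart_at x) q.2.
    exact: (cvg_snd (cdom_near x)).
  apply: filterS2 H D => -[s y] /= H D s01.
  have := H (conj s01 (ex_intro2 _ _ y D erefl)).
  by rewrite chart_atK.
- have D : \forall p \near ((t : R^o), chart_at x x), cimg (chart_at x) p.2.
    exact: (cvg_snd (cimg_near x)).
  by apply: filterS2 fG D => -[s y] /= H D s01; apply: H.
Qed.

Lemma time_ext {W : normedModType R} (f : R -> M -> W) t x :
  smooth_within (`[0, 1] `*` cimg (chart_at x) : set (R^o * 'rV[R]_n))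
      (fun p => f p.1 (cinv (chart_at x) p.2))
      ((t : R^o), chart_at x x) ->
  exists2 g : R -> W, \forall s \near t, s \in `[0, 1] -> f s x = g s &
    derivable g t 1.
Proof.
move=> /time_rep [G [fG dG cG _]]; exists (fun s => G (s, chart_at x x)).
  have H : (s, x) @[s --> t] --> ((t, x) : R * M).
    by apply: (@cvg_pair _ _ _ _ (nbhs t) (nbhs x)) => /=; [exact: cvg_id|exact: cvg_cst].
  exact: (H _ fG).
by have [] := is_derive_slice (nbhs_singleton dG).
Qed.

End Charts.

(** * Uniform bounds, critical points and velocities *)

Section Bounds.
Context {R : realType} {n : nat} (M : manifold R n).
Implicit Types (x y : M) (F : R -> M -> R).

Lemma local_bound F t x : smooth_time_fun F -> t \in `[0, 1] ->
  exists K, \forall q \near ((t, x) : R * M), q.1 \in `[0, 1] ->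
    `|F q.1 q.2| <= K /\ `|deriv01 ((fun s => F s q.2) : R -> R^o) q.1| <= K.
Proof.
move=> Fs t01; have [G [fG dG cG _]] := time_rep (W := R^o) (Fs t x t01).
have tc := @time_chart_continuous _ _ M t x.
set p0 : R^o * 'rV[R]_n := (t, chart_at x x).
have cG0 : {for p0, continuous G}.
  exact: differentiable_continuous (nbhs_singleton dG).
pose K0 := `|G p0| + 1; pose K1 := `|'d G p0 (1, 0)| + 1.
have b0 : \forall q \near ((t, x) : R * M), `|G (q.1, chart_at x q.2)| <= K0.
  have : \forall p \near p0, `|G p| <= K0.
    by apply: (cvgr_le _ (cvg_norm cG0)); rewrite /= ltrDl.
  by move=> /tc.
have b1 : \forall q \near ((t, x) : R * M),
    `|'d G (q.1, chart_at x q.2) (1, 0)| <= K1.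
  have : \forall p \near p0, `|'d G p (1, 0)| <= K1.
    by apply: (cvgr_le _ (cvg_norm cG)); rewrite /= ltrDl.
  by move=> /tc.
have d1 : \forall q \near ((t, x) : R * M),
    differentiable G (q.1, chart_at x q.2) by exact: tc dG.
have fGn := near_join fG.
exists (Num.max K0 K1); near=> q => q01.
rewrite !le_max; split.
  by rewrite (near fG q)//; apply/orP; left; near: q; exact: b0.
apply/orP; right.
have fGq : \forall q' \near q, q'.1 \in `[0, 1] ->
           F q'.1 q'.2 = G (q'.1, chart_at x q'.2).
  by near: q; exact: fGn.
have dq : differentiable G (q.1, chart_at x q.2) by near: q; exact: d1.
have ext : \forall s \near q.1, s \in `[0, 1] ->
    F s q.2 = G (s, chart_at x q.2).
  have H : (s, q.2) @[s --> q.1] --> ((q.1, q.2) : R * M).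
    by apply: (@cvg_pair _ _ _ _ (nbhs q.1) (nbhs q.2)) => /=; [exact: cvg_id|exact: cvg_cst].
  by move: fGq; rewrite {1}(surjective_pairing q) => /H.
rewrite (deriv01E (V := R^o) ext q01 (is_derive_slice dq)).
by near: q; exact: b1.
Unshelve. all: by end_near. Qed.

(** Compactness in the near-covering form: a bound that holds near each point of
    [0, 1] x M for all large K holds everywhere for all large K. *)
Lemma global_bound F : compact [set: M] -> smooth_time_fun F ->
  exists2 K, 0 < K & forall t x, t \in `[0, 1] ->
    `|F t x| <= K /\ `|deriv01 ((fun s => F s x) : R -> R^o) t| <= K.
Proof.
move=> cM Fs.
have cov := iffLR (compact_near_coveringP _) (compact_setX (@segment_compact R 0 1) cM).
pose P K (q : R * M) := q.1 \in `[0, 1] ->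
    `|F q.1 q.2| <= K /\ `|deriv01 ((fun s => F s q.2) : R -> R^o) q.1| <= K.
have H : \forall K \near +oo, `[0, 1] `*` [set: M] `<=` P K.
  apply: cov => -[t x] /= [t01 _]; have [K FK] := local_bound x Fs t01.
  exists (P K, [set i | K <= i]) => /=.
    by split; [exact: FK|exact: (nbhs_pinfty_ge (num_real K))].
  move=> [q i] /= [Hq Ki] q01; have [Ha Hb] := Hq q01.
  by split; [exact: le_trans Ha Ki|exact: le_trans Hb Ki].
have [K K0 HK] := pinfty_ex_gt (real0 _) H.
by exists K => // t x t01; exact: (HK (t, x)).
Qed.

Lemma smooth_time_fun_continuous F t : smooth_time_fun F -> t \in `[0, 1] ->
  continuous (F t).
Proof.
move=> Fs t01 x; have [G [fG dG _ _]] := time_rep (W := R^o) (Fs t x t01).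
have H : (t, y) @[y --> x] --> ((t, x) : R * M).
  by apply: (@cvg_pair _ _ _ _ (nbhs t) (nbhs x)) => /=; [exact: cvg_cst|exact: cvg_id].
have E : \forall y \near x, G (t, chart_at x y) = F t y.
  have E : \forall y \near x, t \in `[0, 1] -> F t y = G (t, chart_at x y).
    exact: (H _ fG).
  by apply: filterS E => y yE; rewrite yE.
rewrite /continuous_at -(nbhs_singleton E).
apply: (@cvg_trans _ (G (t, chart_at x y) @[y --> x])).
  by apply: near_eq_cvg; exact: E.
have T : (t : R^o, chart_at x y) @[y --> x] --> ((t : R^o), chart_at x x).
  exact: (cvg_comp _ _ H (@time_chart_continuous _ _ M t x)).
apply: (cvg_comp _ _ T).
exact: differentiable_continuous (nbhs_singleton dG).
Qed.

(** The maximum of F_t is the required point. *)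
Lemma exists_critical F t : [set: M] !=set0 -> compact [set: M] ->
  smooth_time_fun F -> t \in `[0, 1] -> exists y, dfun (F t) y = 0.
Proof.
move=> M0 cM Fs t01.
have [y _ ymax] := compact_EVT_max M0 cM
  (continuous_subspaceT (smooth_time_fun_continuous Fs t01)).
exists y; apply/matrixP => i j; rewrite !mxE.
have [G [_ dG _ fG]] := time_rep (W := R^o) (Fs t y t01).
apply: diff_at_max.
  apply: (@near_eq_differentiable _ _ _ (fun z => G (t, z))).
    have H : (t, z) @[z --> chart_at y y] --> ((t : R^o), chart_at y y).
      by apply: (@cvg_pair _ _ _ (nbhs (chart_at y y)) (nbhs (t : R^o))
        (nbhs (chart_at y y))); [exact: cvg_cst|exact: cvg_id].
    have E : \forall z \near chart_at y y, t \in `[0, 1] ->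
      F t (cinv (chart_at y) z) = G (t, z) by exact: (H _ fG).
    by apply: filterS E => z zE; rewrite /= zE.
  apply: (@differentiable_comp _ _ _ _ (fun z => ((t : R^o), z)) G).
    by apply: differentiable_pair.
  exact: nbhs_singleton dG.
move=> z /=; rewrite (chart_atK (chart_at_dom y)).
by apply: ymax; rewrite inE.
Qed.

(** The chain rule, applied to local extensions of xi at t and of s |-> phi_s(x)
    at xi t. *)
Lemma velocity_reparam (Phi : R -> M -> M) (xi : R -> R) t x :
  smooth_time_map Phi -> smooth_monotone01 xi -> t \in `[0, 1] ->
  velocity (reparam Phi xi) t x =
  deriv01 (xi : R -> R^o) t *: velocity Phi (xi t) x.
Proof.
move=> [_ Phis] [xis xir _] t01.
have u01 := xir _ t01.
have [g fg dg] := time_ext (f := fun s y => chart_at (Phi (xi t) x) (Phi s y))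
   (Phis (xi t) x u01).
have [h xh dh] := C1_on01_ext (smooth_on_C1_on01 xis) t01.
have ht : xi t = h t by exact: (nbhs_singleton xh).
have ddg : differentiable g (h t) by rewrite -ht; exact/derivable1_diffP.
have ddh : differentiable h t by exact/derivable1_diffP.
have E : \forall s \near t, s \in `[0, 1] ->
    chart_at (Phi (xi t) x) (Phi (xi s) x) = (g \o h) s.
  have hc : h s @[s --> t] --> xi t.
    by rewrite ht; exact: differentiable_continuous.
  have H : \forall s \near t, h s \in `[0, 1] ->
      chart_at (Phi (xi t) x) (Phi (h s) x) = g (h s) by exact: (hc _ fg).
  apply: filterS2 xh H => s xs H s01.
  by rewrite /= xs// H// -xs//; exact: xir.
rewrite /velocity (deriv01E fg u01 (derivableP dg)).
rewrite (deriv01E (V := R^o) xh t01 (derivableP dh)).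
apply: (deriv01E E t01).
have dgh : differentiable (g \o h) t by exact: differentiable_comp.
apply: DeriveDef; first exact: diff_derivable.
have dgl (a : R) : 'd g (h t) a = a *: 'd g (h t) 1.
  by rewrite -linearZ /GRing.scale /= mulr1.
rewrite (deriveE _ dgh) (diff_comp ddh ddg) /= dgl ht.
by rewrite (deriveE _ ddg) (deriveE _ ddh).
Qed.

(** At a critical point y of F_(xi t), the field X with I(X) = dF_(xi t) vanishes,
    so C_fun has the value 0 at the point that phi_(xi t) carries to y. *)
Lemma C_val_reparam (eta : one_form M) (omega : two_form M)
    (Phi : R -> M -> M) F (xi : R -> R) t :
  [set: M] !=set0 -> compact [set: M] -> cosymplectic eta omega ->
  co_hamiltonian eta omega Phi F -> smooth_monotone01 xi -> t \in `[0, 1] ->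
  C_val (reparam Phi xi) eta t = 0.
Proof.
move=> M0 cM ceo [[Phis Phid _ _ _] Fs Fe] xim t01.
have u01 : xi t \in `[0, 1] by case: xim => _ + _; apply.
have [y dFy] := exists_critical M0 cM Fs u01.
have [X PhiX IX] := Fe _ u01.
have [_ [psi [_ _ psiK]]] := Phid _ u01.
have X0 : X y = 0.
  apply: (bij_inj (Icosymp_bijective ceo y)).
  by rewrite IX dFy /Icosymp !mul0mx trmx0 mxE scale0r addr0.
have v0 : velocity Phi (xi t) (psi y) = 0.
  by rewrite -PhiX psiK.
(* when no constant value exists, [C_val] is 0 by default *)
rewrite /C_val; case: xgetP => // c _ /(_ (psi y)) <-.
by rewrite /C_fun velocity_reparam// v0 scaler0 mul0mx mxE.
Qed.

Lemma osc_le (f : M -> R) b : 0 <= b -> (forall x, `|f x| <= b) ->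
  0 <= osc f <= 2 * b.
Proof.
move=> b0 fb; rewrite /osc.
have [[x _]|] := pselect ([set: M] !=set0); last first.
  move=> /set0P/negP/negPn/eqP M0; rewrite (_ : range f = set0).
    by rewrite sup0 inf0 subrr lexx mulr_ge0.
  by rewrite M0 image_set0.
have hs : has_sup (range f).
  split; first by exists (f x), x.
  by exists b => _ [y _ <-]; have := fb y; rewrite ler_norml => /andP[].
have hi : has_inf (range f).
  split; first by exists (f x), x.
  by exists (- b) => _ [y _ <-]; have := fb y; rewrite ler_norml => /andP[].
apply/andP; split.
  rewrite subr_ge0 (@le_trans _ _ (f x))//.
    by apply: ge_inf; [exact: hi.2|exists x].
  by apply: ub_le_sup; [exact: hs.2|exists x].
have : sup (range f) <= b.
  by apply: ge_sup hs.1 _ => _ [y _ <-]; have := fb y; rewrite ler_norml => /andP[].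
have : - b <= inf (range f).
  by apply: lb_le_inf hi.1 _ => _ [y _ <-]; have := fb y; rewrite ler_norml => /andP[].
lra.
Qed.

End Bounds.

(** * The distance between two reparameterizations *)

(** The integral of a nonnegative function is a supremum over the simple
    functions below it, hence monotone for arbitrary functions. This spares a
    proof that the oscillation is measurable in time. *)
Lemma le_integral_nonmeasurable d (T : measurableType d) (R : realType)
    (mu : {measure set T -> \bar R}) (D : set T) (f g : T -> \bar R) :
  (forall t, D t -> 0 <= f t)%E -> (forall t, D t -> f t <= g t)%E ->
  (\int[mu]_(t in D) f t <= \int[mu]_(t in D) g t)%E.
Proof.
move=> f0 fg; rewrite !ge0_integralE//; last first.
  by move=> t Dt; exact: le_trans (f0 _ Dt) (fg _ Dt).
apply: le_ereal_sup => _ [h hf <-]; exists h => // t.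
by apply: le_trans (hf t) _; apply: lee_restrict.
Qed.

Lemma sup_dist_ub (R : realType) (f g : R -> R) :
  (forall t, t \in `[0, 1] -> f t \in `[0, 1]) ->
  (forall t, t \in `[0, 1] -> g t \in `[0, 1]) ->
  forall t, t \in `[0, 1] ->
  `|f t - g t| <= sup [set `|f s - g s| | s in `[0, 1]].
Proof.
move=> f01 g01 t t01; apply: ub_le_sup; last by exists t.
exists 1 => _ [s /= s01 <-].
have := f01 s s01; have := g01 s s01; rewrite !in_itv/= ler_norml.
by move=> /andP[? ?] /andP[? ?]; apply/andP; split; lra.
Qed.

Lemma osc_reparam_le (R : realType) (n : nat) (M : manifold R n)
    (F : R -> M -> R) (K : R) (xi1 xi2 : R -> R) (t : R) :
  smooth_time_fun F ->
  (forall t x, t \in `[0, 1] -> `|F t x| <= K /\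
     `|deriv01 ((fun s => F s x) : R -> R^o) t| <= K) ->
  0 <= K -> xi1 t \in `[0, 1] -> xi2 t \in `[0, 1] ->
  0 <= osc (fun x => reparam_gen F xi1 t x - reparam_gen F xi2 t x) <=
  2 * (K * `|deriv01 (xi1 : R -> R^o) t - deriv01 (xi2 : R -> R^o) t| +
       K * `|xi1 t - xi2 t| * `|deriv01 (xi2 : R -> R^o) t|).
Proof.
move=> Fs FK K0 t1 t2; apply: osc_le; first by rewrite addr_ge0// !mulr_ge0.
move=> x; rewrite /reparam_gen.
set d1 := deriv01 (xi1 : R -> R^o) t; set d2 := deriv01 (xi2 : R -> R^o) t.
have -> : d1 * F (xi1 t) x - d2 * F (xi2 t) x =
   F (xi1 t) x * (d1 - d2) + (F (xi1 t) x - F (xi2 t) x) * d2 by ring.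
apply: le_trans (ler_normD _ _) _; rewrite !normrM.
apply: lerD; apply: ler_wpM2r => //; first by have [] := FK _ x t1.
apply: (@locally_derivable_lipschitz _ (fun s => F s x)) => //.
  by move=> s s01; exact: (time_ext (f := F) (W := R^o) (Fs s x s01)).
by move=> s s01; have [] := FK s x s01.
Qed.

Theorem lemma3p1 (R : realType) (n : nat) (M : manifold R n)
    (eta : one_form M) (omega : two_form M)
    (M_compact : compact [set: M]) (M_connected : connected [set: M])
    (M_cosymplectic : cosymplectic eta omega)
    (F : R -> M -> R) :
  exists2 C : R, 0 < C &
    forall Phi : R -> M -> M, co_hamiltonian eta omega Phi F ->
    forall xi1 xi2 : R -> R, smooth_monotone01 xi1 -> smooth_monotone01 xi2 ->
      (D_CH eta (reparam Phi xi1) (reparam_gen F xi1)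
                (reparam Phi xi2) (reparam_gen F xi2)
       <= C%:E * ham_norm (fun t => xi1 t - xi2 t)%R)%E.
Proof.
(* C comes before Phi, whose being co-Hamiltonian is what makes F smooth; if F is
   not smooth, there is no such Phi. *)
have [Fs|nFs] := pselect (smooth_time_fun F); last first.
  by exists 1 => // Phi [].
have [K K0 FK] := global_bound M_compact Fs.
exists (2 * K); first by rewrite mulr_gt0.
move=> Phi ham xi1 xi2 m1 m2.
have [s1 r1 _] := m1; have [s2 r2 _] := m2.
have C1 := smooth_on_C1_on01 s1; have C2 := smooth_on_C1_on01 s2.
have Cval t : t \in `[0, 1] ->
    `|C_val (reparam Phi xi1) eta t - C_val (reparam Phi xi2) eta t| = 0.
  move=> t01; have [M0|M0] := pselect ([set: M] !=set0).
    by rewrite !(C_val_reparam M0 M_compact M_cosymplectic ham)// subrr normr0.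
  (* on the empty manifold both constants are the same arbitrary choice *)
  rewrite /C_val [X in xget 0 X - _](_ : _ = setT); last first.
    by apply/seteqP; split=> // c _ x; case: M0; exists x.
  rewrite [X in _ - xget 0 X](_ : _ = setT) ?subrr ?normr0//.
  by apply/seteqP; split=> // c _ x; case: M0; exists x.
pose S := sup [set `|xi1 s - xi2 s| | s in `[0, 1]].
have S0 : 0 <= S.
  by apply: le_trans (@sup_dist_ub _ _ _ r1 r2 0 _); rewrite ?in_itv/= ?lexx ?ler01.
pose d (t : R) : R := deriv01 ((xi1 \- xi2) : R -> R^o) t.
pose d2 (t : R) : R := deriv01 (xi2 : R -> R^o) t.
have md f : C1_on01 f -> measurable_fun (`[0, 1] : set R)
    (fun t => deriv01 (f : R -> R^o) t : R).
  move=> fC; apply: subspace_continuous_measurable_fun => //.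
  exact: C1_on01_deriv_continuous.
have Cd : C1_on01 (xi1 \- xi2) by exact: C1_on01B.
rewrite /D_CH /ham_norm -/S.
apply: (@le_trans _ _ (\int[lebesgue_measure]_(t in `[0%R, 1%R])
   ((2 * K)%:E * `|d t|%:E + (2 * K * S)%:E * `|d2 t|%:E))%E).
  apply: le_integral_nonmeasurable => t /= t01; rewrite Cval// addr0 lee_fin.
    by have /andP[] := osc_reparam_le Fs FK (ltW K0) (r1 _ t01) (r2 _ t01).
  have /andP[_] := osc_reparam_le Fs FK (ltW K0) (r1 _ t01) (r2 _ t01).
  move=> /le_trans; apply.
  rewrite /d C1_on01_derivB// mulrDr mulrA lerD2l -/d2 !mulrA ler_wpM2r//.
  rewrite ler_wpM2l// ?sup_dist_ub//.
  by rewrite mulr_ge0// ltW.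
rewrite ge0_integralD//=; last first.
- by apply: measurable_funeM; apply/measurable_EFinP; apply: measurableT_comp => //;
  exact: md.
- by move=> t _; rewrite mule_ge0// lee_fin// !mulr_ge0// ltW.
- by apply: measurable_funeM; apply/measurable_EFinP; apply: measurableT_comp => //;
  exact: md.
- by move=> t _; rewrite mule_ge0// lee_fin// mulr_ge0// ltW.
rewrite !ge0_integralZl_EFin//=; last first.
- by rewrite mulr_ge0// ltW.
- by apply/measurable_EFinP; apply: measurableT_comp => //;
  exact: md.
- by rewrite !mulr_ge0// ltW.
- by apply/measurable_EFinP; apply: measurableT_comp => //;
  exact: md.
set I := (X in (_%:E * X + _ <= _)%E); set I2 := (X in (_ + _%:E * X <= _)%E).
have I0 : (0 <= I)%E by exact: integral_ge0.
rewrite [X in (_ <= _ * (_ + X))%E](_ : _ = I)//.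
have I21 : (I2 <= 1)%E by exact: monotone_variation.
clearbody I I2.
rewrite ge0_muleDr ?lee_fin// addeC leeD2r//.
rewrite EFinM -muleA lee_pmul2l ?lte_fin ?mulr_gt0//.
by rewrite -[leRHS]mule1 lee_wpmul2l ?lee_fin.
Qed.
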